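(* Let $\mathbb F_q$ be a finite field with $q$ elements, let $n\ge 2$, let $a_1,\dots,a_n,b\in\mathbb F_q^*$, and let $m_1,\dots,m_n,k,k_1,\dots,k_n$ be positive integers. Put $M=\operatorname{lcm}[m_1,\dots,m_n]$ and $d_j=\gcd(m_j,q-1)$ for $j=1,\dots,n$. Let $0\le t\le n$ and assume (after indexing) that $d_1,\dots,d_t$ are odd, $d_{t+1},\dots,d_n$ are even, and $d_1,\dots,d_t,d_{t+1}/2,\dots,d_n/2$ are pairwise coprime. Assume also that $$\gcd\Bigl(\sum_{j=1}^n \frac{k_jM}{m_j}-kM,\;q-1\Bigr)=1.$$ Then the number of $(x_1,\dots,x_n)\in\mathbb F_q^n$ satisfying $(a_1x_1^{m_1}+\dots+a_nx_n^{m_n})^k=bx_1^{k_1}\cdots x_n^{k_n}$ equals $$q^{n-1}+(-1)^{n-1}+(-1)^{n-1}\sum_{j=1}^{\lfloor (n-t)/2\rfloor}\eta((-1)^j)\,\sigma_{2j}\bigl(\eta(a_{t+1}),\dots,\eta(a_n)\bigr)\,q^j+E,$$ where $E=\eta((-1)^{n/2}a_1\cdots a_n)\,q^{(n-2)/2}(q-1)$ if $t=0$ and $n$ is even, and $E=0$ otherwise.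
   Context: $\sigma_{2j}(z_1,\dots,z_{n-t})$ denotes the elementary symmetric polynomial of degree $2j$ in $n-t$ variables. $\eta$ is the quadratic character on $\mathbb F_q$: $\eta(x)=+1,-1,0$ according as $x$ is a nonzero square, a non-square, or zero in $\mathbb F_q$. (If $q$ is even then every $d_j$ is odd, so $t=n$ and all terms involving $\eta$ are absent.) $\mathbb F_q^*=\mathbb F_q\setminus\{0\}$. *)

(* Defs.v *)
From HB Require Import structures.
From mathcomp Require Import all_boot all_order all_algebra all_field.
Set Implicit Arguments. Unset Strict Implicit. Unset Printing Implicit Defensive.
Import Order.TTheory GRing.Theory Num.Theory.
Local Open Scope ring_scope.

Definition qeta (F : finFieldType) (x : F) : int :=
  if x == 0 then 0
  else if [exists y : F, y ^+ 2 == x] then 1 else -1.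

Definition esym_at (n : nat) (P : {pred 'I_n}) (f : 'I_n -> int) (r : nat) : int :=
  \sum_(I : {set 'I_n} | (I \subset P) && (#|I| == r)) \prod_(i in I) f i.

(* Main.v *)
Require Import Defs.
From HB Require Import structures.
From mathcomp Require Import all_boot all_order all_algebra all_field.
From mathcomp Require Import ring zify.
Import Order.TTheory GRing.Theory Num.Theory.
Local Open Scope ring_scope.

(** Write S(x) for the sum of the a_j x_j^(m_j).  If some x_j vanishes, the
equation reads S(x) = 0.  If no x_j vanishes, then S(x) is nonzero on solutions,
and c in F^x acts on the x with S(x) nonzero by x_j |-> c^(M/m_j) x_j, multiplying
the quotient of both sides by c^(A - kM) with A the sum of the k_j M/m_j; since
A - kM is prime to q-1, each orbit contributes exactly one value of c.  Hence
N = N0 - N1 + ((q-1)^n - N1)/(q-1), where N0 and N1 count the zeros of S in F^n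
and in (F^x)^n.

Both counts are unchanged when m_j is replaced by 1 (j <= t) or 2 (j > t):
averaging the equation multiplied by y^s over y in F^x, with s divisible by all
exponents but the i-th one, replaces the i-th exponent by its gcd with s.

After this, the number of x with a_j x^(e_j) = v is 1 + eps_j eta(v), minus the
Dirac mass at 0 when x = 0 is excluded, and the counts are values at 0 of
additive convolutions of such functions, which are computed from
1 * eta = 0 and eta * eta = eta(-1) (q delta_0 - 1). *)

(** * Counting the roots of x^d = v *)

(** The flag [z] discards the root 0, so that one argument serves for the counts over $F^n$ and over
    $(F^\times)^n$. *)
Definition power_count {F : finFieldType} (z : bool) (d : nat) (v : F) : int :=
  \sum_(x : F | z ==> (x != 0)) (x ^+ d == v)%:R.

Lemma power_countE (F : finFieldType) z d (v : F) : (0 < d)%N ->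
  power_count z d v
  = (~~ z && (v == 0))%:R + \sum_(x : F | x != 0) (x ^+ d == v)%:R.
Proof.
move=> d0; rewrite /power_count; case: z => /=; first by rewrite add0r.
by rewrite (bigD1 0) //= expr0n gtn_eqF //= eq_sym.
Qed.

Lemma power_count_scale (F : finFieldType) z d s (y v : F) :
  (d %| s)%N -> y != 0 -> power_count z d (y ^+ s * v) = power_count z d v.
Proof.
move=> /dvdnP[r ->] y0; rewrite /power_count.
have yr0 : y ^+ r != 0 by rewrite expf_neq0.
rewrite (reindex_inj (mulfI yr0)) /=; apply: eq_big => x.
  by rewrite mulf_eq0 (negPf yr0).
by move=> _; rewrite exprMn -exprM (inj_eq (mulfI (expf_neq0 _ y0))).
Qed.

(* The unimodular matrix (u, s'; v, d') given by Bezout turns x^d / y^s into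
   the gcd-th power of a single coordinate. *)
Lemma sum_units_pair_gcd (F : finFieldType) d s (w : F) :
  (0 < d)%N -> (0 < s)%N ->
  (\sum_(y : F | y != 0) \sum_(x : F | x != 0) (x ^+ d == y ^+ s * w)%:R)%R
  = (\sum_(y : F | y != 0) \sum_(x : F | x != 0) (x ^+ gcdn d s == w)%:R)%R
    :> int.
Proof.
move=> d0 s0; case: (egcdnP s d0) => u v Huv _.
set e := gcdn d s in Huv *.
have e0 : (0 < e)%N by rewrite gcdn_gt0 d0.
have [d' Ed] : exists d', d = (d' * e)%N by apply/dvdnP/dvdn_gcdl.
have [s' Es] : exists s', s = (s' * e)%N by apply/dvdnP/dvdn_gcdr.
have d'0 : (0 < d')%N by move: d0; rewrite Ed; case: (d').
have s'0 : (0 < s')%N by move: s0; rewrite Es; case: (s').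
have Huv' : (u * d' = v * s' + 1)%N.
  apply/eqP; rewrite -(eqn_pmul2r e0); apply/eqP; rewrite mulnDl mul1n -!mulnA.
  by rewrite -Ed -Es.
have u0 : (0 < u)%N by move: Huv'; case: (u) => //; rewrite mul0n addn1.
(* The exponent matrix of [h] has determinant [u * d' - v * s' = 1]; [h'] is given by its
   inverse. *)
pose h (p : F * F) := (p.1 ^+ d' * p.2 ^+ v, p.2 ^+ u * p.1 ^+ s').
pose h' (p : F * F) := (p.1 ^+ u / p.2 ^+ v, p.2 ^+ d' / p.1 ^+ s').
rewrite !pair_big /= (reindex_onto h h') /=; last first.
  move=> [y x] /= /andP[y0 x0]; rewrite /h /h' /=.
  have X0 k : x ^+ k != 0 by rewrite expf_neq0.
  have Y0 k : y ^+ k != 0 by rewrite expf_neq0.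
  rewrite !exprMn !exprVn -!exprM Huv' (mulnC d' v) (mulnC d' u) (mulnC s' u).
  rewrite (mulnC s' v) Huv' !exprD !expr1.
  by congr pair; field; rewrite ?X0 ?Y0.
apply: eq_big => [[y x]|[y x]] /=.
  rewrite /h /h' /= !mulf_eq0 !expf_eq0 d'0 u0 s'0 /=.
  have [->|y0] /= := eqVneq y 0; first by rewrite ?orbT ?andbF.
  have [->|x0] /= := eqVneq x 0; first by rewrite ?orbT ?andbF.
  rewrite ?andbF /= xpair_eqE.
  have X0 k : x ^+ k != 0 by rewrite expf_neq0.
  have Y0 k : y ^+ k != 0 by rewrite expf_neq0.
  rewrite !exprMn -!exprM (mulnC d' u) (mulnC d' s') (mulnC v u) (mulnC s' v).
  rewrite Huv' !exprD !expr1; apply/andP; split; apply/eqP;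
  by field; rewrite ?X0 ?Y0.
rewrite /h /h' /= !mulf_eq0 !expf_eq0 d'0 u0 s'0 /=.
move=> /andP[/andP[/norP[y0 _] /norP[x0 _]] _].
rewrite !exprMn -!exprM Huv exprD.
have -> : (d' * s = s' * d)%N by rewrite Ed Es; lia.
(* From [u * d = v * s + e] and [d' * s = s' * d], both sides contain the unit [A * B]; cancelling
   it leaves [x ^+ e == w]. *)
set A := x ^+ (v * s); set B := y ^+ (s' * d).
have A0 : A != 0 by rewrite expf_neq0.
have B0 : B != 0 by rewrite expf_neq0.
have -> : A * x ^+ e * B = A * B * x ^+ e by ring.
have -> : B * A * w = A * B * w by ring.
by rewrite (inj_eq (mulfI (mulf_neq0 A0 B0))).
Qed.

Lemma sum_units_const (F : finFieldType) (c : int) :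
  \sum_(y : F | y != 0) c = (#|F|.-1)%:R * c.
Proof.
rewrite sumr_const mulr_natl; congr (_ *+ _).
by have := cardC1 (0 : F); rewrite /predC1; move<-; apply: eq_card.
Qed.

(** The root 0 contributes equally to both sides; the nonzero roots are handled by the unimodular
    substitution. *)
Lemma sum_power_count (F : finFieldType) z d s (w : F) :
  (0 < d)%N -> (0 < s)%N ->
  \sum_(y : F | y != 0) power_count z d (y ^+ s * w)
  = (#|F|.-1)%:R * power_count z (gcdn d s) w.
Proof.
move=> d0 s0; rewrite -sum_units_const.
under eq_bigr => y y0 do
  rewrite power_countE // mulf_eq0 expf_eq0 (negPf y0) andbF /=.
under [RHS]eq_bigr do rewrite power_countE ?gcdn_gt0 ?d0 //.
by rewrite !big_split /= sum_units_pair_gcd.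
Qed.

Lemma card_finField_pred_gt0 (F : finFieldType) : (0 < #|F|.-1)%N.
Proof. by have := finNzRing_gt1 F; case: #|F| => [|[]]. Qed.

Lemma finField_expf_pred (F : finFieldType) (y : F) :
  y != 0 -> y ^+ #|F|.-1 = 1.
Proof.
move=> y0; apply: (mulfI y0); rewrite -exprS prednK ?mulr1 ?expf_card //.
exact: ltnW (finNzRing_gt1 F).
Qed.

(** This is the averaging identity for [s = #|F|.-1], where every [y ^+ s] equals 1. *)
Lemma power_count_gcd (F : finFieldType) z d (w : F) : (0 < d)%N ->
  power_count z d w = power_count z (gcdn d #|F|.-1) w.
Proof.
move=> d0; have q0 := card_finField_pred_gt0 F.
have := @sum_power_count F z d #|F|.-1 w d0 q0.
under eq_bigr => y y0 do rewrite finField_expf_pred // mul1r.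
rewrite sum_units_const; apply: mulfI; by rewrite pnatr_eq0 -lt0n.
Qed.

Lemma power_count1 (F : finFieldType) z (w : F) :
  power_count z 1 w = 1 - (z && (w == 0))%:R.
Proof.
rewrite power_countE //; have [->|w0] := eqVneq w 0.
  rewrite andbT big1; last by move=> x x0; rewrite expr1 (negPf x0).
  by case: z.
rewrite !andbF (bigD1 w) //= expr1 eqxx big1 ?addr0 ?add0r ?subr0 //.
by move=> x /andP[_ xw]; rewrite expr1 (negPf xw).
Qed.

(** * Square roots and the quadratic character *)

(** Translation by 1 permutes F, so q times 1 vanishes in F; if 2 were 0 with q odd, this would give
    1 = 0. *)
Lemma odd_card_two_neq0 (F : finFieldType) : odd #|F| -> (2%:R : F) != 0.
Proof.
move=> oq; apply/eqP => two0.
have : \sum_(x : F) (x + 1) = \sum_(x : F) x.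
  by rewrite [RHS](reindex_inj (addIr 1)).
rewrite big_split /= -[RHS]addr0 => /addrI; rewrite sumr_const.
rewrite -[#|_|]odd_double_half oq mulrnDr -mul2n mulrnA two0 mul0rn addr0.
by move/eqP; rewrite oner_eq0.
Qed.

Lemma power_count2 (F : finFieldType) z (v : F) : odd #|F| ->
  power_count z 2 v = 1 + qeta v - (z && (v == 0))%:R.
Proof.
move=> /odd_card_two_neq0 two0; rewrite power_countE // /qeta.
have [->|v0] := eqVneq v 0.
  rewrite !andbT big1; last by move=> x x0; rewrite expf_eq0 (negPf x0).
  by case: z.
rewrite !andbF add0r subr0; case: ifP => [/existsP[y /eqP yv]|/negbT/existsPn nex].
  have y0 : y != 0 by apply: contraNneq v0 => y0; rewrite -yv y0 expr0n.
  have yN : - y != y.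
    apply: contraNneq two0 => yN.
    have : (2%:R : F) * y = 0 by rewrite mulr_natl mulr2n -{1}yN addNr.
    by move/eqP; rewrite mulf_eq0 (negPf y0) orbF.
  rewrite (bigD1 y) //= (bigD1 (- y)) /=; last by rewrite oppr_eq0 y0.
  rewrite sqrrN yv eqxx big1 ?addr0 // => x /andP[/andP[x0 xy] xNy].
  by rewrite -yv eqf_sqr (negPf xy) (negPf xNy).
by rewrite big1 // => x _; rewrite (negPf (nex x)).
Qed.

Lemma qeta0 (F : finFieldType) : qeta (0 : F) = 0.
Proof. by rewrite /qeta eqxx. Qed.

Lemma qeta1 (F : finFieldType) : qeta (1 : F) = 1.
Proof.
by rewrite /qeta oner_eq0; case: ifP => // /existsP[]; exists 1; rewrite expr1n.
Qed.

Lemma qeta_mul_sqr (F : finFieldType) (y x : F) :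
  y != 0 -> qeta (y ^+ 2 * x) = qeta x.
Proof.
move=> y0; rewrite /qeta mulf_eq0 expf_eq0 (negPf y0) /=.
suff -> : [exists w : F, w ^+ 2 == y ^+ 2 * x] = [exists w : F, w ^+ 2 == x] by [].
apply/existsP/existsP => -[w /eqP Hw].
  exists (w / y); rewrite expr_div_n Hw mulrC mulKf ?expf_neq0 //.
by exists (y * w); rewrite exprMn Hw.
Qed.

(** Each x has exactly one square, so the root counts 1 + eta(v) add up to q. *)
Lemma sum_qeta (F : finFieldType) : odd #|F| -> \sum_(x : F) qeta x = 0.
Proof.
move=> oq; have E : \sum_(v : F) power_count false 2 v = #|F|%:R.
  rewrite /power_count exchange_big /= -sum1_card natr_sum.
  apply: eq_bigr => x _; rewrite (bigD1 (x ^+ 2)) //= eqxx big1 ?addr0 //.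
  by move=> y; rewrite eq_sym => /negPf ->.
move: E; under eq_bigr do rewrite power_count2 //= subr0.
rewrite big_split /= sumr_const => E.
by apply: (addrI (#|F|%:R)); rewrite addr0.
Qed.

Lemma qeta_cases (F : finFieldType) (x : F) : x != 0 ->
  (exists2 y, y != 0 & x = y ^+ 2) /\ qeta x = 1 \/ qeta x = -1.
Proof.
move=> x0; rewrite /qeta (negPf x0); case: ifP; last by right.
move=> /existsP[y /eqP yx]; left; split=> //; exists y => //.
by apply: contraNneq x0 => y0; rewrite -yx y0 expr0n.
Qed.

(* For a non-square [x], every term of sum_y (eta(xy) + eta(y)) is nonpositive
   while the sum vanishes, so every term vanishes. *)
Lemma qetaM (F : finFieldType) (x y : F) : odd #|F| ->
  qeta (x * y) = qeta x * qeta y.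
Proof.
move=> oq; have [->|x0] := eqVneq x 0; first by rewrite mul0r qeta0 mul0r.
have [[[w w0 ->] _]|Ex] := @qeta_cases F x x0.
  by rewrite qeta_mul_sqr // -[w ^+ 2]mulr1 qeta_mul_sqr // qeta1 mul1r.
(* The sign is reversed because [psumr_eq0P] wants nonnegative terms. *)
rewrite Ex mulN1r; apply/eqP; rewrite -addr_eq0 -oppr_eq0; apply/eqP; move: y isT.
apply/(psumr_eq0P (P := xpredT)).
  move=> y _; have [->|y0] := eqVneq y 0; first by rewrite mulr0 !qeta0.
  have [[[w w0 ->] _]|->] := @qeta_cases F y y0.
    by rewrite mulrC qeta_mul_sqr // Ex -[w ^+ 2]mulr1 qeta_mul_sqr // qeta1.
  by have [[_ ->]|->] := @qeta_cases F (x * y) (mulf_neq0 x0 y0).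
rewrite sumrN big_split /= sum_qeta // addr0.
by have := sum_qeta F oq; rewrite (reindex_inj (mulfI x0)) => ->; rewrite oppr0.
Qed.

Lemma qetaX (F : finFieldType) (x : F) k : odd #|F| -> qeta (x ^+ k) = qeta x ^+ k.
Proof.
move=> oq; elim: k => [|k IH]; first by rewrite !expr0 qeta1.
by rewrite !exprS qetaM // IH.
Qed.

Lemma qeta_prod (F : finFieldType) (I : finType) (f : I -> F) : odd #|F| ->
  qeta (\prod_i f i) = \prod_i qeta (f i).
Proof.
move=> oq; apply: (big_morph (@qeta F) _ (qeta1 F)) => x y; exact: qetaM.
Qed.

Lemma qeta_sqr (F : finFieldType) (x : F) : x != 0 -> qeta x * qeta x = 1.
Proof. by move=> x0; have [[_ ->]|->] := @qeta_cases F x x0. Qed.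

Lemma qetaV (F : finFieldType) (x : F) : qeta x^-1 = qeta x.
Proof.
have [->|x0] := eqVneq x 0; first by rewrite invr0.
by rewrite -(@qeta_mul_sqr F x x^-1 x0) expr2 mulfK.
Qed.

(** For v = 0 each term with w nonzero is eta(-1). Otherwise the term is eta(v/w - 1), and v/w - 1
    takes every value except -1 once, so the vanishing total of eta leaves -eta(-1). *)
Lemma qeta_conv (F : finFieldType) (v : F) : odd #|F| ->
  \sum_(w : F) qeta w * qeta (v - w)
  = qeta (-1 : F) * (#|F|%:R * (v == 0)%:R - 1).
Proof.
move=> oq; rewrite (bigD1 0) //= qeta0 mul0r add0r.
have [->|v0] := eqVneq v 0.
  transitivity (\sum_(w : F | w != 0) qeta (-1 : F)).
    apply: eq_bigr => w w0; rewrite sub0r -[- w]mulN1r (qetaM _ _ w) // mulrCA.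
    by rewrite qeta_sqr // mulr1.
  rewrite sum_units_const mulr1 mulrC -subn1 natrB //.
  exact: ltnW (finNzRing_gt1 F).
transitivity (\sum_(w : F | w != 0) qeta (v / w - 1)).
  apply: eq_bigr => w w0; rewrite -(@qeta_mul_sqr F w (v / w - 1)) //.
  by rewrite -qetaM //; congr qeta; field.
rewrite mulr0 sub0r mulrN1.
rewrite (reindex_onto (fun u : F => v / (u + 1)) (fun w => v / w - 1)) /=; last first.
  by move=> w w0; rewrite subrK invf_div mulrCA divff // mulr1.
have := sum_qeta F oq; rewrite (bigD1 (-1)) //= addrC.
move/eqP; rewrite addr_eq0 => /eqP <-; apply: eq_big => u.
  rewrite mulf_eq0 (negPf v0) invr_eq0 addr_eq0 /=.
  have [//|u1 /=] := eqVneq u (-1).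
  by rewrite invf_div mulrCA divff // mulr1 addrK eqxx.
move=> /andP[_ /eqP ->] //.
Qed.

(** * Additive convolutions and diagonal equations *)

Definition convolution {F : finFieldType} {n : nat} (f : 'I_n -> F -> int)
    (v : F) : int :=
  \sum_(x : {ffun 'I_n -> F} | \sum_i x i == v) \prod_i f i (x i).

(** The i-th factor counts the x with $a_i x^{d_i} = w$, so the value at 0 counts the zeros of the
    diagonal form. *)
Definition diag_convolution {F : finFieldType} {n : nat} (z : bool)
    (a : 'I_n -> F) (d : 'I_n -> nat) : int :=
  convolution (fun i w => power_count z (d i) (w / a i)) 0.

Lemma eq_convolution (F : finFieldType) n (f g : 'I_n -> F -> int) v :
  (forall i w, f i w = g i w) -> convolution f v = convolution g v.
Proof. by move=> fg; apply: eq_bigr => x _; apply: eq_bigr => i _. Qed.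

(** The hyperplane of vectors with coordinate sum 0 is stable under scaling; this is why the point
    is 0. *)
Lemma convolution_scale0 (F : finFieldType) n (f : 'I_n -> F -> int) (c : F) :
  c != 0 -> convolution f 0 = convolution (fun i w => f i (c * w)) 0.
Proof.
move=> c0; rewrite /convolution.
pose h (c : F) (x : {ffun 'I_n -> F}) : {ffun 'I_n -> F} := [ffun i => c * x i].
have hK (b b' : F) : b * b' = 1 -> cancel (h b') (h b).
  by move=> bb x; apply/ffunP => i; rewrite !ffunE mulrA bb mul1r.
rewrite (reindex (h c)) /=; last first.
  by exists (h c^-1) => x _; rewrite hK ?mulVf ?mulfV.
apply: eq_big => x; last by move=> _; apply: eq_bigr => i _; rewrite ffunE.
under eq_bigr do rewrite ffunE.
by rewrite -mulr_sumr mulf_eq0 (negPf c0).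
Qed.

Lemma card_diag_zeros (F : finFieldType) n z (a : 'I_n -> F) (m : 'I_n -> nat) :
  (forall i, a i != 0) ->
  \sum_(x : {ffun 'I_n -> F} | [forall i, z ==> (x i != 0)])
     (\sum_i a i * x i ^+ m i == 0)%:R
  = diag_convolution z a m.
Proof.
move=> a0; rewrite /diag_convolution /convolution /power_count.
under [RHS]eq_bigr => v _ do rewrite bigA_distr_big_dep.
rewrite [RHS]exchange_big /=; apply: eq_big => x.
  by rewrite inE; apply/forallP/forallP.
move=> _; pose y : {ffun 'I_n -> F} := [ffun i => a i * x i ^+ m i].
have prodE (v : {ffun 'I_n -> F}) : \prod_i (x i ^+ m i == v i / a i)%:R
      = (v == y)%:R :> int.
  have [->|vy] := eqVneq v y.
    by rewrite big1 // => i _; rewrite ffunE mulrC mulKf ?eqxx.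
  have /existsP[i vi] : [exists i, v i != y i].
    rewrite -negb_forall; apply: contraNN vy => /forallP vy.
    by apply/eqP/ffunP => i; apply/eqP.
  rewrite (bigD1 i) //= [_ == _](_ : _ = false) ?mul0r //.
  apply: contraNF vi => /eqP xi; rewrite ffunE xi mulrC divfK //.
under [RHS]eq_bigr do rewrite prodE.
have -> : \sum_i a i * x i ^+ m i = \sum_i y i.
  by apply: eq_bigr => i _; rewrite ffunE.
have [Sy|Sy] := boolP (\sum_i y i == 0).
  rewrite (bigD1 y) //= eqxx big1 ?addr0 // => v /andP[_ /negPf ->] //.
rewrite big1 // => v Sv; case: eqP => // vy; by rewrite -vy Sv in Sy.
Qed.

(* Multiplying the equation by an s-th power only affects the i-th exponent;
   averaging over all s-th powers replaces it by its gcd with s. *)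
Lemma diag_convolution_replace (F : finFieldType) n z (a : 'I_n -> F)
    (d : 'I_n -> nat) (i : 'I_n) s :
  (0 < d i)%N -> (0 < s)%N -> (forall j, j != i -> d j %| s)%N ->
  diag_convolution z a d
  = diag_convolution z a (fun j => if j == i then gcdn (d i) s else d j).
Proof.
move=> d0 s0 ds; have q0 := card_finField_pred_gt0 F.
have Q0 : (#|F|.-1)%:R != 0 :> int by rewrite pnatr_eq0 -lt0n.
apply: (mulfI Q0); rewrite -sum_units_const.
transitivity (\sum_(y : F | y != 0) convolution
    (fun j w => power_count z (d j) (y ^+ s * w / a j)) 0).
  apply: eq_bigr => y y0.
  exact: (@convolution_scale0 F n _ (y ^+ s) (expf_neq0 s y0)).
rewrite /convolution exchange_big /= mulr_sumr; apply: eq_bigr => x _.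
rewrite [in RHS](bigD1 i) //= eqxx mulrA.
rewrite -(sum_power_count F z (d i) s) // mulr_suml; apply: eq_bigr => y y0.
rewrite (bigD1 i) //= mulrA; congr (_ * _); apply: eq_bigr => j ji.
by rewrite (negPf ji) -mulrA power_count_scale ?ds.
Qed.

Lemma eq_diag_convolution (F : finFieldType) n z (a : 'I_n -> F)
    (d e : 'I_n -> nat) :
  d =1 e -> diag_convolution z a d = diag_convolution z a e.
Proof. by move=> de; apply: eq_convolution => i w; rewrite de. Qed.

(** Exponents are replaced one index at a time. Those already replaced divide the original ones, so
    the divisibility hypothesis persists. *)
Lemma diag_convolution_reduce (F : finFieldType) n z (a : 'I_n -> F)
    (d e s : 'I_n -> nat) :
  (forall i, 0 < d i)%N -> (forall i, 0 < s i)%N ->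
  (forall i, gcdn (d i) (s i) = e i) ->
  (forall i j, j != i -> d j %| s i)%N ->
  diag_convolution z a d = diag_convolution z a e.
Proof.
move=> d0 s0 ge ds.
have H r : (r <= n)%N -> diag_convolution z a d
    = diag_convolution z a (fun j => if (j < r)%N then e j else d j).
  elim: r => [|r IH] rn; first exact: eq_diag_convolution.
  rewrite IH ?(ltnW rn) // (@diag_convolution_replace F n z a _ (Ordinal rn)
    (s (Ordinal rn))) //=; first last.
  - move=> j ji; case: ifP => _; last exact: ds.
    by rewrite -ge; apply: dvdn_trans (dvdn_gcdl _ _) (ds _ _ ji).
  - by rewrite ltnn.
  apply: eq_diag_convolution => j; rewrite ltnn ge.
  have [->|ji] := eqVneq j (Ordinal rn); first by rewrite ltnSn.
  by rewrite [(j < r.+1)%N]ltnS (leq_eqVlt j r) (negPf (ji : (j : nat) != r)).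
rewrite (H n (leqnn n)); apply: eq_diag_convolution => j; by rewrite ltn_ord.
Qed.

Lemma diag_convolution_gcd (F : finFieldType) n z (a : 'I_n -> F)
    (m : 'I_n -> nat) :
  (forall i, 0 < m i)%N ->
  diag_convolution z a m = diag_convolution z a (fun i => gcdn (m i) #|F|.-1).
Proof. by move=> m0; apply: eq_convolution => i w; exact: power_count_gcd. Qed.

(** * Convolving combinations of 1, the Dirac mass and the character *)

Lemma convolution_rec (F : finFieldType) n (f : 'I_n.+1 -> F -> int) (v : F) :
  convolution f v
  = \sum_(w : F) f ord0 w * convolution (fun i => f (lift ord0 i)) (v - w).
Proof.
rewrite /convolution.
pose h (p : F * {ffun 'I_n -> F}) : {ffun 'I_n.+1 -> F} :=
  [ffun i => oapp p.2 p.1 (unlift ord0 i)].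
pose h' (x : {ffun 'I_n.+1 -> F}) : F * {ffun 'I_n -> F} :=
  (x ord0, [ffun i => x (lift ord0 i)]).
have h0 p : h p ord0 = p.1 by rewrite ffunE unlift_none.
have hS p i : h p (lift ord0 i) = p.2 i by rewrite ffunE liftK.
rewrite (reindex h) /=; last first.
  exists h' => [[w x]|x] _.
    by congr pair; [rewrite h0 | apply/ffunP => i; rewrite ffunE hS].
  apply/ffunP => i; case: (unliftP ord0 i) => [j ->|->].
    by rewrite hS ffunE.
  by rewrite h0.
under [RHS]eq_bigr do rewrite mulr_sumr.
rewrite pair_big_dep /=; apply: eq_big => [[w x]|[w x] _] /=.
  rewrite big_ord_recl h0 /= addrC; under eq_bigr do rewrite hS.
  by rewrite eq_sym -subr_eq eq_sym.
by rewrite big_ord_recl h0 /=; under eq_bigr do rewrite hS.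
Qed.

(** The even and odd parts evaluated at x are the coordinates of p modulo $X^2 - x$ in the basis 1,
    X; this lemma and the next describe multiplication by c + eX. *)
Lemma horner_even_poly_cons (c e x : int) (p : {poly int}) :
  (even_poly ((c%:P + e *: 'X) * p)).[x]
  = c * (even_poly p).[x] + e * x * (odd_poly p).[x].
Proof.
rewrite mulrDl mul_polyC -scalerAl (mulrC 'X) even_polyD !even_polyZ even_polyMX.
by rewrite !hornerD !hornerZ hornerMX; ring.
Qed.

Lemma horner_odd_poly_cons (c e x : int) (p : {poly int}) :
  (odd_poly ((c%:P + e *: 'X) * p)).[x]
  = c * (odd_poly p).[x] + e * (even_poly p).[x].
Proof.
by rewrite mulrDl mul_polyC -scalerAl (mulrC 'X) odd_polyD !odd_polyZ
  odd_polyMX !hornerE.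
Qed.

(* In the convolution algebra spanned by the constant 1, the Dirac mass at 0
   and h, the last two generate Z[X]/(X^2 - kappa q) modulo the ideal of
   constants, and total mass determines the remaining coefficient. *)
Lemma convolution_closed (F : finFieldType) n (h : F -> int) (kappa c : int)
    (eps : 'I_n -> int) (v : F) :
  \sum_(w : F) h w = 0 ->
  (forall u, \sum_(w : F) h w * h (u - w)
             = kappa * (#|F|%:R * (u == 0)%:R - 1)) ->
  let p := \prod_i (c%:P + eps i *: 'X) in
  let E := (even_poly p).[kappa * #|F|%:R] in
  let O := (odd_poly p).[kappa * #|F|%:R] in
  #|F|%:R * convolution (fun i w => 1 + c * (w == 0)%:R + eps i * h w) v
  = (#|F|%:R + c) ^+ n - E + #|F|%:R * E * (v == 0)%:R + #|F|%:R * O * h v.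
Proof.
move=> h0 hh; set q : int := #|F|%:R.
elim: n eps v => [|n IH] eps v /=.
  rewrite big_ord0 -[1 : {poly int}]/(1%:P) even_polyC odd_polyC.
  rewrite hornerC horner0 expr0 subrr mulr0 mulr1 mul0r add0r addr0; congr (_ * _); rewrite /convolution.
  have E0 (x : {ffun 'I_0 -> F}) : x = [ffun=> 0] by apply/ffunP => -[].
  rewrite (eq_bigl (fun=> 0 == v)); last by move=> x; rewrite big_ord0.
  rewrite eq_sym; case: eqP => _; last by rewrite big_pred0.
  rewrite (big_pred1 [ffun=> 0]); last by move=> x /=; rewrite (E0 x) eqxx.
  by rewrite big_ord0.
rewrite convolution_rec mulr_sumr.
set p := \prod_(i < n) (c%:P + eps (lift ord0 i) *: 'X).
rewrite big_ord_recl -/p horner_even_poly_cons horner_odd_poly_cons.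
under eq_bigr do rewrite mulrCA IH -/p.
set E := (even_poly p).[_]; set O := (odd_poly p).[_].
set K := (q + c) ^+ n; set e := eps ord0.
pose dl (u : F) : int := (u == 0)%:R.
have S1 (g : F -> int) : \sum_w dl w * g w = g 0.
  rewrite (bigD1 0) //= /dl eqxx mul1r big1 ?addr0 // => w /negPf ->.
  by rewrite mul0r.
have S2 (g : F -> int) : \sum_w dl (v - w) * g w = g v.
  rewrite (bigD1 v) //= /dl subrr eqxx mul1r big1 ?addr0 // => w wv.
  by rewrite subr_eq0 eq_sym (negPf wv) mul0r.
have S3 : \sum_w h (v - w) = 0.
  rewrite -[RHS]h0 [RHS](reindex_inj (inv_inj (subKr v))) //.
(* [L] is opaque so that [big_split] does not break up [K - E]. *)
have [L LE] : exists L : int, L = K - E by exists (K - E).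
have Sc : \sum_(w : F) L = L * q by rewrite sumr_const mulr_natr.
(* The first factor times the inductive value at [v - w] is expanded so that each summand is a
   scalar times one of the known sums. *)
rewrite (eq_bigr (fun w => L + (c * L) * dl w + (e * L) * h w
   + (q * E) * (dl (v - w) * (1 + c * dl w + e * h w)) + (q * O) * h (v - w)
   + (q * O * c) * (dl w * h (v - w)) + (q * O * e) * (h w * h (v - w))));
  last by move=> w _; rewrite /dl LE; ring.
rewrite !big_split /= -!mulr_sumr h0 S3 hh S2 (S1 (fun w => h (v - w))) subr0.
under [X in _ + c * L * X]eq_bigr do rewrite -[dl _]mulr1.
rewrite (S1 (fun=> 1)) Sc -/q exprS -/K /dl LE; ring.
Qed.

(** * Coefficients of the product and elementary symmetric polynomials *)

(** Choose from each factor the X term on a subset and c off it. For r > n the exponent [n - r] is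
    truncated, but no subset has r elements. *)
Lemma coef_prod_affine n (c : int) (eps : 'I_n -> int) r :
  (\prod_i (c%:P + eps i *: 'X))`_r
  = c ^+ (n - r) * \sum_(I : {set 'I_n} | #|I| == r) \prod_(i in I) eps i.
Proof.
under eq_bigr do rewrite addrC.
rewrite bigA_distr /= (eq_bigr (fun J : {set 'I_n} =>
    (c ^+ (n - #|J|) * \prod_(i in J) eps i) *: 'X^#|J|)); last first.
  move=> J _; rewrite (bigID (mem J)) /=.
  rewrite (eq_bigr (fun i => eps i *: 'X)); last by move=> i ->.
  rewrite [X in _ * X](eq_bigr (fun=> c%:P)); last by move=> i /negPf ->.
  rewrite scaler_prod prodr_const prodr_const.
  rewrite (_ : #|[pred i | i \notin J]| = (n - #|J|)%N); last first.
    have := cardC (mem J); rewrite card_ord.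
    have -> : #|[predC mem J]| = #|[pred i | i \notin J]| by apply: eq_card.
    by move/(congr1 (subn^~ #|J|)); rewrite addKn.
  by rewrite -polyC_exp mulrC mul_polyC scalerA.
rewrite coef_sumMXn mulr_sumr; apply: eq_bigr => J /eqP <- //.
Qed.

(** A subset not contained in P picks up a zero factor. *)
Lemma sum_prod_mask n (P : {pred 'I_n}) (f : 'I_n -> int) r :
  \sum_(I : {set 'I_n} | #|I| == r) \prod_(i in I) (if i \in P then f i else 0)
  = esym_at P f r.
Proof.
rewrite /esym_at (bigID (fun I : {set 'I_n} => I \subset P)) /=.
rewrite [X in _ + X]big1 ?addr0; last first.
  move=> I /andP[_ /subsetPn[i iI iP]]; rewrite (bigD1 i) //= (negPf iP).
  by rewrite mul0r.
apply: eq_big => [I|I /andP[_ /subsetP IP]]; first by rewrite andbC.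
by apply: eq_bigr => i /IP ->.
Qed.

Lemma esym_at_gt_card n (P : {pred 'I_n}) (f : 'I_n -> int) r :
  (#|P| < r)%N -> esym_at P f r = 0.
Proof.
move=> Pr; rewrite /esym_at big_pred0 // => I.
by apply/negP => /andP[/subset_leq_card + /eqP Ir]; rewrite Ir leqNgt Pr.
Qed.

Lemma esym_at0 n (P : {pred 'I_n}) (f : 'I_n -> int) : esym_at P f 0 = 1.
Proof.
rewrite /esym_at (big_pred1 set0) ?big_set0 // => I /=.
by rewrite cards_eq0 andb_idl // => /eqP ->; apply/subsetP => i; rewrite inE.
Qed.

(** Case c = -1, for nonzero coordinates: the sign $(-1)^{n-2j}$ is always $(-1)^n$, and j = 0 gives
    the isolated first term. *)
Lemma horner_even_prod_affine n (P : {pred 'I_n}) (f : 'I_n -> int) (x : int) :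
  (even_poly (\prod_i ((-1)%:P + (if i \in P then f i else 0) *: 'X))).[x]
  = (-1) ^+ n + (-1) ^+ n *
      \sum_(1 <= j < (#|P|)./2.+1) esym_at P f (2 * j) * x ^+ j.
Proof.
set p := \prod_i _.
have coefE j : (even_poly p)`_j = (-1) ^+ n * esym_at P f (2 * j).
  rewrite coef_even_poly coef_prod_affine sum_prod_mask -mul2n.
  have [jn|nj] := leqP (2 * j) n.
    by rewrite -[in LHS]signr_odd oddB // oddM /= addbF signr_odd.
  by rewrite esym_at_gt_card ?mulr0 // (leq_ltn_trans _ nj) //
    -[n in leqRHS]card_ord max_card.
rewrite (@horner_coef_wide _ (#|P|)./2.+1); last first.
  apply/leq_sizeP => j Pj; rewrite coefE esym_at_gt_card ?mulr0 //.
  by rewrite mul2n -[#|P|]odd_double_half; move: Pj; case: odd; lia.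
rewrite -(big_mkord xpredT (fun j => (even_poly p)`_j * x ^+ j)).
rewrite big_nat_recl //= coefE muln0 esym_at0 !mulr1; congr (_ + _).
rewrite big_add1 /= mulr_sumr; apply: eq_bigr => j _.
by rewrite coefE mulrA.
Qed.

(** Case c = 0, for all of $F^n$: the product is one monomial of degree n. *)
Lemma horner_even_prod_linear n (eps : 'I_n -> int) (x : int) :
  (even_poly (\prod_i (0%:P + eps i *: 'X))).[x]
  = if odd n then 0 else \prod_i eps i * x ^+ n./2.
Proof.
under eq_bigr do rewrite add0r.
rewrite scaler_prod prodr_const card_ord; set A := \prod_i _.
have -> : even_poly (A *: 'X^n) = if odd n then 0 else A *: 'X^(n./2).
  apply/polyP => i; rewrite coef_even_poly coefZ coefXn.
  have [on|en] := boolP (odd n).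
    rewrite coef0 (_ : i.*2 == n = false) ?mulr0 //.
    by apply/negP => /eqP E; rewrite -E odd_double in on.
  rewrite coefZ coefXn -{1}(even_halfK en).
  by rewrite (inj_eq double_inj).
by case: ifP => _; rewrite ?horner0 // hornerZ hornerXn.
Qed.

(** * Solutions with all coordinates nonzero *)

Lemma sum_units_solutions (F : finFieldType) n (a : 'I_n -> F) (b : F)
    (m kk : 'I_n -> nat) (k M : nat) :
  (0 < n)%N -> b != 0 -> (0 < M)%N -> (forall j, m j %| M)%N ->
  (0 < k)%N -> (forall j, 0 < kk j)%N ->
  gcdz (\sum_(j < n) ((kk j * (M %/ m j))%N)%:Z - ((k * M)%N)%:Z)
       (#|F|.-1)%:Z = 1 ->
  ((#|F|.-1)%:R * \sum_(x : {ffun 'I_n -> F} | [forall i, x i != 0])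
     ((\sum_j a j * x j ^+ m j) ^+ k == b * \prod_j x j ^+ kk j)%:R)%R
  = (\sum_(x : {ffun 'I_n -> F} | [forall i, x i != 0])
     (\sum_j a j * x j ^+ m j != 0)%:R)%R :> int.
Proof.
move=> n0 b0 M0 mM k0 kk0 cop.
pose sol (x : {ffun 'I_n -> F}) : bool :=
  (\sum_j a j * x j ^+ m j) ^+ k == b * \prod_j x j ^+ kk j.
pose h (c : F) (x : {ffun 'I_n -> F}) : {ffun 'I_n -> F} :=
  [ffun j => c ^+ (M %/ m j) * x j].
have hK (c c' : F) : c * c' = 1 -> cancel (h c') (h c).
  by move=> cc x; apply/ffunP => i; rewrite !ffunE mulrA -exprMn cc expr1n mul1r.
rewrite -sum_units_const.
transitivity (\sum_(c : F | c != 0)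
   \sum_(x : {ffun 'I_n -> F} | [forall i, x i != 0])
   ((sol (h c x))%:R : int)).
  apply: eq_bigr => c c0; rewrite (reindex (h c)) /=; last first.
    by exists (h c^-1) => x _; rewrite hK ?mulVf ?mulfV.
  apply: eq_bigl => x; apply: eq_forallb => i.
  by rewrite ffunE mulf_eq0 expf_eq0 (negPf c0) andbF.
rewrite exchange_big /=; apply: eq_bigr => x /forallP x0.
set S := \sum_j _; pose R := b * \prod_j x j ^+ kk j.
have R0 : R != 0.
  by rewrite mulf_neq0 //; apply/prodf_neq0 => j _; rewrite expf_neq0.
pose A := (\sum_(j < n) kk j * (M %/ m j))%N; pose B := (k * M)%N.
(* [E] is a natural number congruent to A - B modulo q - 1; the difference A - B itself may be
   negative. *)
pose E := (A + (#|F|.-2) * B)%N.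
have Eq : #|F|.-1 = #|F|.-2.+1.
  by case: #|F| (finNzRing_gt1 F) => [|[|r]].
have solE c : c != 0 -> sol (h c x) = (c ^+ B * S ^+ k == c ^+ A * R).
  move=> c0; rewrite /sol; congr (_ == _).
    rewrite /B mulnC exprM -exprMn; congr (_ ^+ _).
    rewrite /S mulr_sumr; apply: eq_bigr => j _.
    by rewrite ffunE exprMn -exprM divnK // mulrCA.
  rewrite /R mulrCA; congr (_ * _).
  rewrite /A expr_sum -big_split /=; apply: eq_bigr => j _.
  by rewrite ffunE exprMn -exprM mulnC.
have A0 : (0 < A)%N.
  rewrite /A (bigD1 (Ordinal n0)) //= ltn_addr // muln_gt0 kk0 divn_gt0.
    by rewrite dvdn_leq.
  by apply: dvdn_gt0 (mM _).
have copE : gcdn E #|F|.-1 = 1%N.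
  have EZ : E%:Z = #|F|.-1%:Z * B%:Z
      + (\sum_(j < n) ((kk j * (M %/ m j))%N)%:Z - B%:Z).
    have <- : A%:Z = \sum_(j < n) ((kk j * (M %/ m j))%N)%:Z.
      exact: (big_morph Posz PoszD (erefl _)).
    have -> : #|F|.-1%:Z = #|F|.-2%:Z + 1 by rewrite [in LHS]Eq -addn1 PoszD.
    by rewrite /E PoszD PoszM; ring.
  have := cop; rewrite gcdzC -(gcdzMDl B%:Z) mulrC -EZ gcdzC.
  by case.
have [S0|S0] := eqVneq S 0.
  rewrite big1 // => c c0; rewrite solE // S0 expr0n gtn_eqF // mulr0 eq_sym.
  by rewrite mulf_eq0 expf_eq0 (negPf c0) (negPf R0) andbF.
rewrite (eq_bigr (fun c => (c ^+ E == S ^+ k / R)%:R)); last first.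
  move=> c c0; rewrite solE //; congr (nat_of_bool _)%:R.
  have cq : c ^+ (#|F|.-2 * B) * c ^+ B = 1.
    by rewrite -exprD -mulSnr -Eq exprM finField_expf_pred // expr1n.
  have C0 : c ^+ (#|F|.-2 * B) != 0 by rewrite expf_neq0.
  rewrite -(inj_eq (mulfI C0)) mulrA cq mul1r mulrA -exprD addnC -/E.
  by rewrite -(inj_eq (mulIf R0) (c ^+ E)) divfK // eq_sym.
(* As [E] is prime to q - 1, raising to the power [E] hits the nonzero value [S ^+ k / R] for
   exactly one c. *)
have := @power_count_gcd F true E (S ^+ k / R).
rewrite copE power_count1 mulf_eq0 expf_eq0 invr_eq0 (negPf S0) (negPf R0).
rewrite !andbF subr0; apply.
by rewrite /E addn_gt0 A0.
Qed.

Lemma sum_units_vectors (F : finFieldType) n :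
  \sum_(x : {ffun 'I_n -> F} | [forall i, x i != 0]) (1 : int)
  = (#|F|.-1)%:R ^+ n.
Proof.
transitivity (\prod_(i < n) \sum_(x : F | x != 0) (1 : int)).
  rewrite bigA_distr_big_dep /=; apply: eq_big => [x|x _]; last by rewrite big1.
  by rewrite inE; apply/forallP/forallP.
by rewrite prodr_const card_ord sum_units_const mulr1.
Qed.

(** A zero coordinate kills the right-hand side, and then the equation says S = 0. *)
Lemma sum_solutions_split (F : finFieldType) n (a : 'I_n -> F) (b : F)
    (m kk : 'I_n -> nat) (k : nat) :
  (0 < k)%N -> (forall j, 0 < kk j)%N ->
  let S (x : {ffun 'I_n -> F}) := \sum_j a j * x j ^+ m j in
  let sol (x : {ffun 'I_n -> F}) := S x ^+ k == b * \prod_j x j ^+ kk j in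
  let nz (x : {ffun 'I_n -> F}) := [forall i, x i != 0] in
  (\sum_x (sol x)%:R)%R
  = (\sum_x (S x == 0)%:R - \sum_(x | nz x) (S x == 0)%:R
     + \sum_(x | nz x) (sol x)%:R)%R :> int.
Proof.
move=> k0 kk0 S sol nz.
rewrite (bigID nz) [X in _ = X - _ + _](bigID nz) /=.
rewrite (addrC (\sum_(x | nz x) (S x == 0)%:R)) addrK addrC; congr (_ + _).
apply: eq_bigr => x; rewrite negb_forall => /existsP[i]; rewrite negbK => /eqP xi.
rewrite /sol (bigD1 i) //= xi expr0n gtn_eqF // mul0r mulr0.
by rewrite expf_eq0 k0.
Qed.

(** * Reduction to exponents 1 and 2, and evaluation *)

Lemma diag_convolution_quadratic (F : finFieldType) n z (a : 'I_n -> F)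
    (d : 'I_n -> nat) t :
  (forall j, 0 < d j)%N ->
  (forall j : 'I_n, (j < t)%N -> odd (d j)) ->
  (forall j : 'I_n, (t <= j)%N -> ~~ odd (d j)) ->
  (forall i j : 'I_n, i != j ->
     coprime (if (i < t)%N then d i else (d i)./2)
             (if (j < t)%N then d j else (d j)./2)) ->
  diag_convolution z a d
  = diag_convolution z a (fun j => if (j < t)%N then 1%N else 2%N).
Proof.
move=> d0 dodd deven cop.
pose d' (j : 'I_n) := if (j < t)%N then d j else (d j)./2.
(* Every other [d j] divides [s i], while pairwise coprimality makes the gcd of [d i] and [s i]
   equal to 1 or 2 according to the parity of [d i]. *)
pose s (i : 'I_n) := (2 * \prod_(j | j != i) d' j)%N.
have Ed j : d j = ((if (j < t)%N then 1 else 2) * d' j)%N.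
  rewrite /d'; case: ltnP => tj; first by rewrite mul1n.
  by rewrite mul2n even_halfK ?deven.
have d'0 j : (0 < d' j)%N.
  by move: (d0 j); rewrite Ed muln_gt0 => /andP[].
have copP i : coprime (d' i) (\prod_(j | j != i) d' j).
  elim/big_rec: _ => [|j r ji IH]; first exact: coprimen1.
  by rewrite coprimeMr IH cop // eq_sym.
apply: (@diag_convolution_reduce F n z a d _ s) => // [i|i|i j ji].
- by rewrite muln_gt0 /=; apply/prodn_gt0.
- rewrite /s; case: ltnP => ti.
    apply/eqP; rewrite -/(coprime _ _) coprimeMr coprimen2 dodd //=.
    by have := copP i; rewrite {1}/d' ti.
  have -> : d i = (2 * d' i)%N by rewrite Ed ltnNge ti.
  by rewrite -muln_gcdr (eqP (copP i)).
rewrite /s Ed (bigD1 j) //=; apply: dvdn_mul; first by case: ifP.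
exact: dvdn_mulr.
Qed.

(** [h] and [kappa] stand for eta and eta(-1) but remain parameters, to allow zero values when no
    exponent is 2. At v = 0 the odd part drops out. *)
Lemma diag_convolution_closed (F : finFieldType) n (z : bool) (a : 'I_n -> F) t
    (h : F -> int) (kappa : int) :
  (forall j, a j != 0) ->
  h 0 = 0 -> \sum_(w : F) h w = 0 ->
  (forall u, \sum_(w : F) h w * h (u - w)
             = kappa * (#|F|%:R * (u == 0)%:R - 1)) ->
  (forall j : 'I_n, (t <= j)%N -> odd #|F| /\ h =1 @qeta F) ->
  let c : int := - (z%:R) in
  let eps (j : 'I_n) : int := if (t <= j)%N then qeta (a j) else 0 in
  #|F|%:R * diag_convolution z a (fun j => if (j < t)%N then 1%N else 2%N)
  = (#|F|%:R + c) ^+ n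
    + (#|F|%:R - 1)
      * (even_poly (\prod_j (c%:P + eps j *: 'X))).[kappa * #|F|%:R].
Proof.
move=> a0 h00 hsum hh hq c eps.
have -> : diag_convolution z a (fun j => if (j < t)%N then 1%N else 2%N)
    = convolution (fun i (w : F) => 1 + c * (w == 0)%:R + eps i * h w) 0.
  apply: eq_convolution => i w; rewrite /eps /c.
  have zE : (z && (w / a i == 0)%R)%:R = z%:R * (w == 0)%R%:R :> int.
    rewrite mulf_eq0 invr_eq0 (negPf (a0 i)) orbF.
    by case: (w == 0); rewrite ?andbT ?andbF ?mulr1 ?mulr0.
  case: ltnP => ti; first by rewrite power_count1 zE mul0r addr0 mulNr.
  have [oq ->] := hq i ti.
  by rewrite power_count2 // zE qetaM // qetaV; ring.
rewrite (@convolution_closed F n h kappa) // eqxx h00 mulr1 mulr0 addr0.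
by rewrite mulrBl mul1r -addrA (addrC (- _)) addrA.
Qed.

(** * Assembling the number of solutions *)

Theorem theorem4 (F : finFieldType) (n : nat) (a : 'I_n -> F) (b : F)
    (m kk : 'I_n -> nat) (k t : nat) :
  (2 <= n)%N ->
  (forall j, a j != 0) -> b != 0 ->
  (forall j, 0 < m j)%N -> (0 < k)%N -> (forall j, 0 < kk j)%N ->
  let q := #|F| in
  let M := \big[lcmn/1%N]_(j < n) m j in
  let d := fun j : 'I_n => gcdn (m j) q.-1 in
  (t <= n)%N ->
  (forall j : 'I_n, (j < t)%N -> odd (d j)) ->
  (forall j : 'I_n, (t <= j)%N -> ~~ odd (d j)) ->
  (forall i j : 'I_n, i != j ->
     coprime (if (i < t)%N then d i else (d i)./2)
             (if (j < t)%N then d j else (d j)./2)) ->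
  gcdz (\sum_(j < n) ((kk j * (M %/ m j))%N)%:Z - ((k * M)%N)%:Z) (q.-1)%:Z = 1 ->
  (#|[set x : {ffun 'I_n -> F} |
        (\sum_(j < n) a j * x j ^+ m j) ^+ k == b * \prod_(j < n) x j ^+ kk j]|%:Z
   = (q%:Z) ^+ n.-1 + (-1) ^+ n.-1
     + (-1) ^+ n.-1 *
       \sum_(1 <= j < ((n - t)./2).+1)
          qeta ((-1) ^+ j : F)
          * esym_at [pred i : 'I_n | (t <= i)%N] (fun i => qeta (a i)) (2 * j)
          * (q%:Z) ^+ j
     + (if (t == 0%N) && ~~ odd n then
          qeta ((-1) ^+ (n./2) * \prod_(j < n) a j) * (q%:Z) ^+ (n - 2)./2 * (q%:Z - 1)
        else 0)).
Proof.
move=> n2 a0 b0 m0 k0 kk0 q M d tn dodd deven cop gcdE.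
have d0 j : (0 < d j)%N by rewrite gcdn_gt0 m0.
have n0 : (0 < n)%N := ltnW n2.
have M0 : (0 < M)%N.
  by rewrite /M; elim/big_rec: _ => // j r _ r0; rewrite lcmn_gt0 m0.
have mM j : (m j %| M)%N by apply: (biglcmn_sup j).
have qpos : (0 < q)%N := ltnW (finNzRing_gt1 F).
(* An even [d j] divides q - 1, so q is odd. *)
have oq : (t < n)%N -> odd q.
  move=> ltn; have := deven (Ordinal ltn) (leqnn t); rewrite /d => ev.
  have : ~~ odd q.-1.
    apply: contraNN ev => oq1; apply: dvdn_odd oq1; exact: dvdn_gcdr.
  by rewrite -{2}(prednK qpos) /= .
(* For t = n the zero function with [kappa = 0] satisfies the same relations, whatever the parity of
   q. *)
pose h : F -> int := if (t < n)%N then @qeta F else fun=> 0.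
pose kappa : int := if (t < n)%N then qeta (-1 : F) else 0.
have h0 : h 0 = 0 by rewrite /h; case: ifP => // _; exact: qeta0.
have hsum : \sum_(w : F) h w = 0.
  by rewrite /h; case: ifP => [/oq|_]; [exact: sum_qeta | rewrite big1].
have hh u : \sum_(w : F) h w * h (u - w) = kappa * (#|F|%:R * (u == 0)%:R - 1).
  rewrite /h /kappa; case: ifP => [/oq|_]; first exact: qeta_conv.
  by rewrite [RHS]mul0r big1 // => w _; rewrite mul0r.
have hq (j : 'I_n) : (t <= j)%N -> odd #|F| /\ h =1 @qeta F.
  move=> tj; have ltn := leq_ltn_trans tj (ltn_ord j).
  by rewrite /h ltn; split=> //; exact: oq.
have diagE z := @diag_convolution_closed F n z a t h kappa a0 h0 hsum hh hq.
have redE z : \sum_(x : {ffun 'I_n -> F} | [forall i, z ==> (x i != 0)])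
      (\sum_i a i * x i ^+ m i == 0)%:R
    = diag_convolution z a (fun j => if (j < t)%N then 1%N else 2%N).
  rewrite card_diag_zeros // diag_convolution_gcd //.
  exact: diag_convolution_quadratic.
pose Q : int := q%:R.
have Q1E : (q.-1)%:R = Q - 1 :> int by rewrite /Q -{2}(prednK qpos) -natr1 addrK.
have Q0 : Q != 0 by rewrite /Q pnatr_eq0 -lt0n.
have Q10 : Q - 1 != 0.
  by rewrite -Q1E pnatr_eq0 -lt0n; exact: card_finField_pred_gt0.
set P := [pred i : 'I_n | (t <= i)%N].
have cardP : #|P| = (n - t)%N.
  by rewrite -sum1_card -(big_geq_mkord t n xpredT (fun=> 1%N))
    sum_nat_const_nat muln1.
set T := \sum_(1 <= j < _) _.
have even1 : (even_poly (\prod_(j < n) ((- (true%:R : int))%:P +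
      (if (t <= j)%N then qeta (a j) else 0) *: 'X))).[kappa * Q]
    = (-1) ^+ n + (-1) ^+ n * T.
  have := @horner_even_prod_affine n P (fun i => qeta (a i)) (kappa * Q).
  rewrite cardP => ->; congr (_ + _ * _); apply: eq_big_nat => j /andP[j1 jt].
  (* A nonempty range for j forces t < n, so [kappa] is eta(-1) and its j-th power is eta of
     $(-1)^j$. *)
  have ltn : (t < n)%N by move: j1 jt; lia.
  rewrite /kappa ltn exprMn -qetaX; last exact: oq.
  by rewrite /Q natz; ring.
set Eterm := (if _ then _ else _).
have even0 : (Q - 1) * (even_poly (\prod_(j < n) ((- (false%:R : int))%:P +
      (if (t <= j)%N then qeta (a j) else 0) *: 'X))).[kappa * Q]
    = Q * Eterm.
  rewrite (_ : - false%:R = 0 :> int) // horner_even_prod_linear /Eterm.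
  case: ifP => on; first by rewrite andbF !mulr0.
  (* For t > 0 the factor at index 0 vanishes. *)
  rewrite andbT; have [t0|t0] := eqVneq t 0%N; last first.
    have tpos : (0 < t)%N by rewrite lt0n.
    rewrite (bigD1 (Ordinal n0)) //= leqNgt tpos /= !mul0r !mulr0 //.
  have ltn : (t < n)%N by rewrite t0.
  have oq' := oq ltn.
  rewrite /kappa ltn qetaM // qetaX // qeta_prod // exprMn.
  rewrite (eq_bigr (fun j => qeta (a j))); last by move=> j _; rewrite t0.
  (* The extra power of [Q] is the factor in front of [Eterm]. *)
  have -> : n./2 = ((n - 2)./2).+1 by move: n2; lia.
  by rewrite [in Q ^+ _]exprS /Q natz; ring.
have N0E := diagE false; have NsE := diagE true.
rewrite /= -/q -/Q -!redE in N0E NsE.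
rewrite even1 in NsE; rewrite even0 in N0E.
have splitE := @sum_solutions_split F n a b m kk k k0 kk0.
have unitE := @sum_units_solutions F n a b m kk k M n0 b0 M0 mM k0 kk0 gcdE.
rewrite /= in splitE.
rewrite -/q Q1E in unitE.
have cardE : #|[set x : {ffun 'I_n -> F} |
    (\sum_(j < n) a j * x j ^+ m j) ^+ k == b * \prod_(j < n) x j ^+ kk j]|%:Z
  = \sum_(x : {ffun 'I_n -> F})
    ((\sum_(j < n) a j * x j ^+ m j) ^+ k == b * \prod_(j < n) x j ^+ kk j)%:R.
  rewrite -natz -sum1_card natr_sum big_mkcond /=; apply: eq_bigr => x _.
  by rewrite inE; case: (_ == _).
have compE : \sum_(x : {ffun 'I_n -> F} | [forall i, x i != 0])
     (\sum_j a j * x j ^+ m j != 0)%:R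
  = (Q - 1) ^+ n - \sum_(x : {ffun 'I_n -> F} | [forall i, x i != 0])
     (\sum_j a j * x j ^+ m j == 0)%:R.
  rewrite -Q1E -sum_units_vectors -sumrB; apply: eq_bigr => x _.
  by case: (_ == 0).
rewrite compE in unitE; rewrite cardE splitE.
rewrite (eq_bigl xpredT) in N0E; last by move=> x; apply/forallP.
rewrite subr0 in N0E; move: N0E NsE unitE; rewrite /= -[Posz q]natz -/Q.
set N0 := \sum_x _; set Nz := \sum_(x | _) _; set Nu := \sum_(x | _) _.
rewrite -(prednK n0) [n.-1.+1.-1]/= (exprS (-1)) (exprS Q).
set X := (Q - 1) ^+ _; set Y := Q ^+ _; set s := (-1) ^+ _ => HN0 HNz HNu.
(* [N0] and [Nz] are known after multiplication by Q, [Nu] after multiplication by Q - 1. On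
   substitution the terms in $(Q-1)^n$ cancel. *)
apply: (mulfI (mulf_neq0 Q0 Q10)).
transitivity ((Q - 1) * (Q * N0) - (Q - 1) * (Q * Nz) + Q * ((Q - 1) * Nu)).
  by ring.
rewrite HNu mulrBr HNz HN0; ring.
Qed.
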